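(* Let $\{a_n\}_{n\ge 0}$ and $\{c_n\}_{n\ge 0}$ be two sequences of complex numbers, and define $$b_n=\sum_{k=0}^n\binom{n}{k}a_k,\qquad d_n=\sum_{k=0}^n\binom{n}{k}(-1)^{n-k}c_k\quad(n\ge 0),$$ so that $c_n=\sum_{k=0}^n\binom{n}{k}d_k$. Then for every integer $n\ge 0$, $$\sum_{k=0}^n\binom{n}{k}a_kc_k=\sum_{m=0}^n\binom{n}{m}d_m\,\nabla^m b_n .$$
   Context: $\nabla$ denotes the backward difference operator acting on the sequence $\{b_n\}$: $\nabla b_n=b_n-b_{n-1}$, $\nabla^0 b_n=b_n$, and $\nabla^{m}b_n=\nabla(\nabla^{m-1}b_n)=\nabla^{m-1}b_n-\nabla^{m-1}b_{n-1}$. For $0\le m\le n$, $\nabla^m b_n$ only involves $b_{n-m},\dots,b_n$. *)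

(* Defs.v *)
From mathcomp Require Import all_boot all_algebra.
From mathcomp Require Import reals complex.
Set Implicit Arguments.
Unset Strict Implicit.
Unset Printing Implicit Defensive.
Import GRing.Theory.
Local Open Scope ring_scope.

(* Backward difference. Sequences start at index 0, so b_(n-1) has no meaning
   at n = 0; as 0.-1 = 0, the value there is 0. That value never enters
   [iter m nabla b n] when m <= n, which involves b_(n-m), ..., b_n only. *)
Definition nabla (V : zmodType) (b : nat -> V) (n : nat) : V := b n - b n.-1.

(* Main.v *)
Require Import Defs.
From mathcomp Require Import all_boot all_algebra.
From mathcomp Require Import reals complex.
Set Implicit Arguments.
Unset Strict Implicit.
Unset Printing Implicit Defensive.
Import GRing.Theory.
Local Open Scope ring_scope.

(* Iterated differences shift the binomial transform:
   nabla^m b_(n+m) = sum_k C(n,k) a_(k+m). Both the inversion formula and the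
   convolution identity then follow by interchanging a double sum with
   C(n,k) C(k,m) = C(n,m) C(n-m,k-m), applied to (-1)^(k-m) c_m and to
   a_k d_m respectively. *)

(** Multiplied by [m! (k - m)! (n - k)!], either side becomes [n!]. *)
Lemma mul_bin_subset (n k m : nat) : (m <= k <= n)%N ->
  ('C(n, k) * 'C(k, m) = 'C(n, m) * 'C(n - m, k - m))%N.
Proof.
move=> /andP[le_mk le_kn]; have le_mn := leq_trans le_mk le_kn.
have gt0 : (0 < m`! * (k - m)`! * (n - k)`!)%N by rewrite !muln_gt0 !fact_gt0.
apply/eqP; rewrite -(eqn_pmul2r gt0) -mulnA (mulnA 'C(k, m)) bin_fact //.
have := bin_fact (leq_sub2r m le_kn); rewrite subnBA // subnK // => eq_nkm.
by rewrite -[(m`! * _ * _)%N]mulnA mulnACA eq_nkm -mulnA !bin_fact.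
Qed.

(** Induction on [m] by Pascal's rule. With the index written [n + m], each difference is taken at a
    successor, so the value of [nabla] at 0 never arises. *)
Lemma iter_nabla_binomial_transform (R : pzRingType) (a b : nat -> R)
    (hb : forall n : nat, b n = \sum_(0 <= k < n.+1) 'C(n, k)%:R * a k)
    (m n : nat) :
  iter m (@nabla R) b (n + m)%N
  = \sum_(0 <= k < n.+1) 'C(n, k)%:R * a (k + m)%N.
Proof.
elim: m n => [|m IHm] n /=.
  by rewrite addn0 hb; apply: eq_bigr => k _; rewrite addn0.
rewrite /nabla addnS /= -addSn !IHm [X in X - _]big_nat_recl //.
under eq_bigr => k _ do rewrite binS natrD mulrDl.
rewrite big_split /= bin0 -(bin0 n) addrA.
(* The [k = 0] term and the [C(n, k.+1)] half of Pascal's rule rebuild the subtracted sum, up to a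
   top term with [C(n, n.+1) = 0]. The other half is the result. *)
rewrite -(big_nat_recl _ _ (fun k => 'C(n, k)%:R * a (k + m)%N)) //.
rewrite big_nat_recr //= bin_small // mul0r addr0 [X in X - _]addrC addrK.
by apply: eq_bigr => k _; rewrite addSnnS.
Qed.

Lemma exchange_sum_binomial (R : pzRingType) (F : nat -> nat -> R) (n : nat) :
  \sum_(0 <= k < n.+1) 'C(n, k)%:R * \sum_(0 <= m < k.+1) 'C(k, m)%:R * F m k
  = \sum_(0 <= m < n.+1) 'C(n, m)%:R *
      \sum_(0 <= k < (n - m).+1) 'C(n - m, k)%:R * F m (k + m)%N.
Proof.
(* Widening the triangle to a square guarded by [m <= k] makes the two sums interchangeable. *)
transitivity (\sum_(0 <= k < n.+1) \sum_(0 <= m < n.+1 | (m <= k)%N)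
   ('C(n, k) * 'C(k, m))%:R * F m k).
  apply: eq_big_nat => k /andP[_ lt_kn].
  rewrite big_distrr (big_nat_widen _ _ n.+1) //=.
  by apply: eq_bigr => m _; rewrite mulrA natrM.
rewrite (exchange_big_dep_nat xpredT) //=.
apply: eq_big_nat => m /andP[_ le_mn].
transitivity ('C(n, m)%:R *
    \sum_(m <= k < n.+1) 'C(n - m, k - m)%:R * F m k); last first.
  congr (_ * _); rewrite -{1}(add0n m) big_addn subSn //.
  by under eq_bigr => k _ do rewrite addnK.
rewrite big_distrr (big_nat_widenl m 0) //=.
rewrite big_nat_cond [RHS]big_nat_cond.
apply: eq_bigr => k /andP[/andP[_ lt_kn] le_mk].
by rewrite mul_bin_subset ?le_mk // natrM mulrA.
Qed.

Lemma sum_signed_binomial (R : pzRingType) (n : nat) :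
  \sum_(0 <= k < n.+1) 'C(n, k)%:R * (-1) ^+ k = (n == 0)%:R :> R.
Proof.
(* The indicator is [0 ^+ n], expanded as [(1 - 1) ^+ n]. *)
rewrite -expr0n -[in RHS](subrr 1) exprBn_comm; last exact: commr1.
rewrite big_mkord; apply: eq_bigr => k _.
by rewrite !expr1n !mulr1 mulr_natl.
Qed.

Lemma binomial_inversion (R : comPzRingType) (c d : nat -> R)
    (hd : forall n : nat,
        d n = \sum_(0 <= k < n.+1) 'C(n, k)%:R * (-1) ^+ (n - k)%N * c k)
    (n : nat) :
  c n = \sum_(0 <= k < n.+1) 'C(n, k)%:R * d k.
Proof.
under eq_bigr => k _.
  rewrite hd; under eq_bigr => m _ do rewrite -mulrA.
  over.
rewrite (exchange_sum_binomial (fun m k => (-1) ^+ (k - m)%N * c m)).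
(* The coefficient of [c m] is an alternating sum over row [n - m], hence zero unless [m = n]. *)
under eq_big_nat => m /andP[_ le_mn].
  under eq_bigr => k _ do rewrite addnK mulrA.
  rewrite -big_distrl /= sum_signed_binomial subn_eq0.
  over.
rewrite big_nat_recr //= leqnn binn !mul1r big_nat big1 ?add0r //.
by move=> m /andP[_ lt_mn]; rewrite leqNgt lt_mn mul0r mulr0.
Qed.

Theorem theorem1 (R : realType) (a c b d : nat -> R[i])
    (hb : forall n : nat, b n = \sum_(0 <= k < n.+1) 'C(n, k)%:R * a k)
    (hd : forall n : nat,
        d n = \sum_(0 <= k < n.+1) 'C(n, k)%:R * (-1) ^+ (n - k)%N * c k) :
  (forall n : nat, c n = \sum_(0 <= k < n.+1) 'C(n, k)%:R * d k) /\
  (forall n : nat,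
      \sum_(0 <= k < n.+1) 'C(n, k)%:R * a k * c k
      = \sum_(0 <= m < n.+1) 'C(n, m)%:R * d m * iter m (@nabla R[i]) b n).
Proof.
have hc := binomial_inversion hd; split=> // n.
under eq_bigr => k _.
  rewrite hc -mulrA big_distrr /=.
  under eq_bigr => m _ do rewrite mulrCA.
  over.
rewrite (exchange_sum_binomial (fun m k => a k * d m)).
apply: eq_big_nat => m /andP[_ le_mn].
(* Since [m <= n], [n] can be written [(n - m) + m]; the inner sum is then [d m] times the [m]-th
   difference of [b] at [n]. *)
rewrite -[X in iter _ _ _ X](@subnK m n) // -mulrA.
rewrite (iter_nabla_binomial_transform hb).
congr (_ * _); rewrite big_distrr; apply: eq_bigr => k _ /=.
by rewrite mulrA mulrC.
Qed.
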